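(* Let $\Gamma\subset\mathbb{R}^n$ be an $n$-attractor. Then both the interior $\Gamma^\circ$ and the complement $\Gamma^c=\mathbb{R}^n\setminus\Gamma$ are thick.
   Context: A domain in $\mathbb{R}^n$ means a non-empty open subset of $\mathbb{R}^n$. **$n$-attractor.** An iterated function system (IFS) of contracting similarities on $\mathbb{R}^n$ is a collection $\{s_1,\ldots,s_M\}$, $M\geq 2$, of maps $s_m:\mathbb{R}^n\to\mathbb{R}^n$ such that, for some $\rho_m\in(0,1)$, $|s_m(x)-s_m(y)|=\rho_m|x-y|$ for all $x,y\in\mathbb{R}^n$. Its attractor is the unique non-empty compact set $\Gamma\subset\mathbb{R}^n$ with $\Gamma=\bigcup_{m=1}^M s_m(\Gamma)$. The IFS satisfies the open set condition (OSC) if there is a non-empty bounded open set $O\subset\mathbb{R}^n$ with $\bigcup_{m=1}^M s_m(O)\subset O$ and $s_m(O)\cap s_{m'}(O)=\emptyset$ for $m\neq m'$. A set $\Gamma\subset\mathbb{R}^n$ is an $n$-attractor if it is the attractor of an IFS of contracting similarities that satisfies the OSC and has $\sum_{m=1}^M\rho_m^n=1$. **Thickness.** For $S\subset\mathbb{R}^n$ let $\mathcal{Q}(S)$ be the set of open cubes contained in $S$ with edges parallel to the coordinate axes; $l(Q)$ is the edge length of a cube $Q$. Let $\Omega\subsetneqq\mathbb{R}^n$ be a domain. (i) $\Omega$ is $E$-thick if for any $c_1,c_2,c_3,c_4>0$ and $j_0\in\mathbb{N}$ there are $c_5,c_6,c_7,c_8>0$ such that for any $j\in\mathbb{N}$,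 $j\geq j_0$, and any $Q^i\in\mathcal{Q}(\Omega)$ with $c_12^{-j}\leq l(Q^i)\leq c_22^{-j}$ and $c_32^{-j}\leq\operatorname{dist}(Q^i,\partial\Omega)\leq c_42^{-j}$ there exists $Q^e\in\mathcal{Q}(\Omega^c)$ with $c_52^{-j}\leq l(Q^e)\leq c_62^{-j}$ and $c_72^{-j}\leq\operatorname{dist}(Q^e,\partial\Omega)\leq\operatorname{dist}(Q^i,Q^e)\leq c_82^{-j}$. (ii) $\Omega$ is $I$-thick if for any $c_1,c_2,c_3,c_4>0$ and $j_0\in\mathbb{N}$ there are $c_5,c_6,c_7,c_8>0$ such that for any $j\in\mathbb{N}$, $j\geq j_0$, and any $Q^e\in\mathcal{Q}(\Omega^c)$ with $c_12^{-j}\leq l(Q^e)\leq c_22^{-j}$ and $c_32^{-j}\leq\operatorname{dist}(Q^e,\partial\Omega)\leq c_42^{-j}$ there exists $Q^i\in\mathcal{Q}(\Omega)$ with $c_52^{-j}\leq l(Q^i)\leq c_62^{-j}$ and $c_72^{-j}\leq\operatorname{dist}(Q^i,\partial\Omega)\leq\operatorname{dist}(Q^e,Q^i)\leq c_82^{-j}$. (iii) $\Omega$ is thick if it is both $E$-thick and $I$-thick. *)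

(* Defs.v *)
From mathcomp Require Import all_boot all_order all_algebra.
From mathcomp Require Import all_classical all_reals all_analysis.

Set Implicit Arguments.
Unset Strict Implicit.
Unset Printing Implicit Defensive.

Import Order.TTheory GRing.Theory Num.Theory.
Import numFieldNormedType.Exports.

Local Open Scope classical_set_scope.
Local Open Scope ring_scope.

(* R^n is 'rV[R]_n.  The library norm on matrices is the sup norm: it gives the
   usual topology and bounded sets, but distances have to be Euclidean. *)
Definition eucl_norm (R : realType) (n : nat) (x : 'rV[R]_n) : R :=
  Num.sqrt (\sum_(i < n) x 0 i ^+ 2).

Definition eucl_dist (R : realType) (n : nat) (x y : 'rV[R]_n) : R :=
  eucl_norm (x - y).

(* Real-valued, hence meaningful only for nonempty A and B; below it is only
   applied to open cubes and to the boundary of a nonempty proper open set,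
   which is nonempty because R^n is connected. *)
Definition set_dist (R : realType) (n : nat) (A B : set 'rV[R]_n) : R :=
  inf [set eucl_dist x y | x in A & y in B].

Definition boundary (T : topologicalType) (A : set T) : set T :=
  closure A `\` A°.

Definition domain (R : realType) (n : nat) (Om : set 'rV[R]_n) : Prop :=
  Om !=set0 /\ open Om.

Definition contracting_similarity (R : realType) (n : nat) (rho : R)
    (s : 'rV[R]_n -> 'rV[R]_n) : Prop :=
  [/\ 0 < rho, rho < 1 &
      forall x y, eucl_dist (s x) (s y) = rho * eucl_dist x y].

Definition open_set_condition (R : realType) (n M : nat)
    (s : 'I_M -> 'rV[R]_n -> 'rV[R]_n) : Prop :=
  exists O : set 'rV[R]_n,
    [/\ O !=set0, bounded_set O, open O,
        \bigcup_(m in [set: 'I_M]) (s m @` O) `<=` O &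
        forall m m', m != m' -> (s m @` O) `&` (s m' @` O) = set0].

(* For an IFS of contracting similarities exactly one set has this property,
   by Hutchinson's theorem. *)
Definition is_attractor (R : realType) (n M : nat)
    (s : 'I_M -> 'rV[R]_n -> 'rV[R]_n) (Gamma : set 'rV[R]_n) : Prop :=
  [/\ Gamma !=set0, compact Gamma &
      Gamma = \bigcup_(m in [set: 'I_M]) (s m @` Gamma)].

(* There is no n-attractor for n = 0, as the sum of the rho m ^+ 0 is M. *)
Definition n_attractor (R : realType) (n : nat) (Gamma : set 'rV[R]_n) : Prop :=
  exists (M : nat) (rho : 'I_M -> R) (s : 'I_M -> 'rV[R]_n -> 'rV[R]_n),
    [/\ (2 <= M)%N,
        forall m, contracting_similarity (rho m) (s m),
        open_set_condition s,
        \sum_(m < M) rho m ^+ n = 1 &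
        is_attractor s Gamma].

(* Open axis-parallel cubes. *)
Record cube (R : realType) (n : nat) := Cube {
  corner : 'rV[R]_n;
  edge : R;
  edge_gt0 : 0 < edge
}.

Definition cube_set (R : realType) (n : nat) (Q : cube R n) : set 'rV[R]_n :=
  [set x | forall i : 'I_n, corner Q 0 i < x 0 i < corner Q 0 i + edge Q].

(* E-thickness and I-thickness are the same condition with the roles of Om and
   its complement exchanged; here Q ranges over the cubes in S, Q' over those
   in S', and B is the boundary of Om. *)
Definition cube_transfer (R : realType) (n : nat) (S S' B : set 'rV[R]_n) :
    Prop :=
  forall (c1 c2 c3 c4 : R) (j0 : nat), 0 < c1 -> 0 < c2 -> 0 < c3 -> 0 < c4 ->
  exists c5 c6 c7 c8 : R, [/\ 0 < c5, 0 < c6, 0 < c7 & 0 < c8] /\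
    forall (j : nat) (Q : cube R n), (j0 <= j)%N ->
      cube_set Q `<=` S ->
      c1 * 2 ^- j <= edge Q <= c2 * 2 ^- j ->
      c3 * 2 ^- j <= set_dist (cube_set Q) B <= c4 * 2 ^- j ->
      exists Q' : cube R n,
        [/\ cube_set Q' `<=` S',
            c5 * 2 ^- j <= edge Q' <= c6 * 2 ^- j,
            c7 * 2 ^- j <= set_dist (cube_set Q') B,
            set_dist (cube_set Q') B <= set_dist (cube_set Q) (cube_set Q') &
            set_dist (cube_set Q) (cube_set Q') <= c8 * 2 ^- j].

Definition E_thick (R : realType) (n : nat) (Om : set 'rV[R]_n) : Prop :=
  cube_transfer Om (~` Om) (boundary Om).

Definition I_thick (R : realType) (n : nat) (Om : set 'rV[R]_n) : Prop :=
  cube_transfer (~` Om) Om (boundary Om).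

(* Thickness is only defined for proper domains, so being one is part of it. *)
Definition thick (R : realType) (n : nat) (Om : set 'rV[R]_n) : Prop :=
  [/\ domain Om, Om <> setT, E_thick Om & I_thick Om].

(* Main.v *)
Require Import Defs.
From mathcomp Require Import all_boot all_order all_algebra.
From mathcomp Require Import all_classical all_reals all_analysis.
From mathcomp Require Import ring lra.
Import Order.TTheory GRing.Theory Num.Theory.
Import numFieldNormedType.Exports.
Local Open Scope classical_set_scope.
Local Open Scope ring_scope.
Set Implicit Arguments.
Unset Strict Implicit.
Unset Printing Implicit Defensive.


(** Why the theorem holds.

    Let O be the bounded open set of the open set condition.  The tiles s_m(O)
    are disjoint subsets of O, and since the ratios satisfy
    sum rho_m ^ n = 1 they exhaust the volume of O, so they are dense in O.
    Only the following consequence of volume is used: a ball of radius r0 in O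
    missing all the s_m(O) could be copied by all words in the maps, giving
    pairwise disjoint balls inside O whose radii have unbounded sums of n-th
    powers (packing_tower); counting points of a fine lattice forbids that
    (packing_bound).  Density makes O invariant up to arbitrarily small errors,
    so the contraction argument behind the uniqueness of attractors identifies
    Gamma with the closure of O (attractor_eq_closure).  Hence Gamma is the
    closure of its interior, and the image of the interior of Gamma under one
    map misses the image of Gamma under another (attractor_tiles_disjoint).

    Thickness is then reduced to porosity: near each boundary point and at each
    scale t <= 1 there must be a ball of radius comparable to t on the required
    side (porous_transfer); that the new cube is at least as far from the old
    one as from the boundary holds because a segment between a set and its
    complement meets the boundary.  On the inner side, a tile of size t
    containing the point carries a copy of a fixed ball of the interior
    (porous_interior).  On the outer side, Gamma contains deep in its interior
    a tile w(Gamma), and around w(Gamma) the set Gamma is tiled by tiles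
    whose interiors miss w(Gamma).  A small such tile next to a boundary point
    of w(Gamma) supplies a ball off w(Gamma), and w^-1 carries it to a ball off
    Gamma (porous_complement).  The two domains of the theorem share the
    boundary of Gamma, so these two porosity statements give all four
    transfers. *)

(** * Euclidean norm and the topology of row vectors *)

Section Euclidean.
Variables (R : realType) (n : nat).
Implicit Types (x y z : 'rV[R]_n) (A : 'M[R]_n).

Definition dot x y : R := \sum_i x 0 i * y 0 i.

Lemma dotE x y : dot x y = (x *m y^T) 0 0.
Proof. by rewrite mxE; apply: eq_bigr => i _; rewrite mxE. Qed.

Lemma dotC x y : dot x y = dot y x.
Proof. by apply: eq_bigr => i _; rewrite mulrC. Qed.

Lemma dotBl x y z : dot (x - y) z = dot x z - dot y z.
Proof. by rewrite !dotE mulmxBl !mxE. Qed.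

Lemma dotBr x y z : dot z (x - y) = dot z x - dot z y.
Proof. by rewrite dotC dotBl !(dotC z). Qed.

Lemma dotZl a x y : dot (a *: x) y = a * dot x y.
Proof. by rewrite !dotE -scalemxAl !mxE. Qed.

Lemma dotZr a x y : dot x (a *: y) = a * dot x y.
Proof. by rewrite dotC dotZl dotC. Qed.

Lemma dot_ge0 x : 0 <= dot x x.
Proof. by apply: sumr_ge0 => i _; rewrite -expr2 sqr_ge0. Qed.

Lemma dot_eq0 x : dot x x = 0 -> x = 0.
Proof.
move=> /eqP; rewrite psumr_eq0 => [/allP x0|i _]; last first.
  by rewrite -expr2 sqr_ge0.
apply/rowP => i; rewrite mxE; apply/eqP.
by have := x0 i (mem_index_enum i); rewrite -expr2 sqrf_eq0.
Qed.

Lemma eucl_normE x : eucl_norm x = Num.sqrt (dot x x).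
Proof. by congr Num.sqrt; apply: eq_bigr => i _; rewrite expr2. Qed.

Lemma sqr_eucl_norm x : eucl_norm x ^+ 2 = dot x x.
Proof. by rewrite eucl_normE sqr_sqrtr// dot_ge0. Qed.

Lemma eucl_norm_ge0 x : 0 <= eucl_norm x.
Proof. exact: sqrtr_ge0. Qed.

(** The nonnegative square norm of (y.y) x - (x.y) y is y.y times the defect of
    the squared inequality. *)
Lemma cauchy_schwarz x y : dot x y <= eucl_norm x * eucl_norm y.
Proof.
have [xy0|xy0] := leP (dot x y) 0.
  by apply: le_trans xy0 _; rewrite mulr_ge0 ?eucl_norm_ge0.
have yy0 : 0 < dot y y.
  rewrite lt_neqAle dot_ge0 andbT; apply: contraTneq xy0 => /esym/dot_eq0 ->.
  by rewrite -leNgt -(scale0r 0) dotZr mul0r.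
rewrite -(@ler_pXn2r _ 2) ?nnegrE ?(ltW xy0) ?mulr_ge0 ?eucl_norm_ge0//.
rewrite exprMn !sqr_eucl_norm.
have := dot_ge0 (dot y y *: x - dot x y *: y).
rewrite !(dotBl, dotBr, dotZl, dotZr) (dotC y x) => h.
by rewrite -subr_ge0 -(pmulr_rge0 _ yy0); nra.
Qed.

Lemma eucl_normD x y : eucl_norm (x + y) <= eucl_norm x + eucl_norm y.
Proof.
rewrite -(@ler_pXn2r _ 2) ?nnegrE ?addr_ge0 ?eucl_norm_ge0//.
rewrite sqrrD !sqr_eucl_norm -[y]opprK !(dotBl, dotBr).
have := cauchy_schwarz x y.
by rewrite opprK -[- y]scaleN1r !(dotZl, dotZr) (dotC y x); lra.
Qed.

Lemma eucl_normZ a x : eucl_norm (a *: x) = `|a| * eucl_norm x.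
Proof.
by rewrite !eucl_normE dotZl dotZr mulrA -expr2 sqrtrM ?sqr_ge0// sqrtr_sqr.
Qed.

Lemma eucl_dist_ge0 x y : 0 <= eucl_dist x y.
Proof. exact: eucl_norm_ge0. Qed.

Lemma eucl_distxx x : eucl_dist x x = 0.
Proof. by rewrite /eucl_dist subrr -(scale0r 0) eucl_normZ normr0 mul0r. Qed.

Lemma eucl_distC x y : eucl_dist x y = eucl_dist y x.
Proof. by rewrite /eucl_dist -opprB -scaleN1r eucl_normZ normrN1 mul1r. Qed.

Lemma eucl_dist_triangle y x z :
  eucl_dist x z <= eucl_dist x y + eucl_dist y z.
Proof. by rewrite /eucl_dist -[x - z](subrKA y) eucl_normD. Qed.

Lemma coord_le_eucl_norm x i : `|x 0 i| <= eucl_norm x.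
Proof.
rewrite eucl_normE -sqrtr_sqr ler_wsqrtr// /dot (bigD1 i)//= expr2 lerDl.
by apply: sumr_ge0 => j _; rewrite -expr2 sqr_ge0.
Qed.

(** Boxes sit inside Euclidean balls; with n + 1 in place of sqrt n the bound
    is strict and the division by it is legitimate in every dimension. *)
Lemma eucl_norm_lt_coord x a r : 0 < r -> a * n.+1%:R <= r ->
  (forall i, `|x 0 i| <= a) -> eucl_norm x < r.
Proof.
move=> r0 ar xa.
rewrite -(@ltr_pXn2r _ 2) ?nnegrE ?(ltW r0) ?eucl_norm_ge0// sqr_eucl_norm.
have [a0|a0] := ltP a 0.
  rewrite /dot big1 ?exprn_gt0// => i _; have := xa i.
  by move=> /(le_lt_trans)/(_ a0); rewrite normr_lt0.
have : dot x x <= n%:R * a ^+ 2.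
  apply: (@le_trans _ _ (\sum_(i < n) a ^+ 2)).
    apply: ler_sum => i _; rewrite -expr2 -real_normK ?num_real//.
    by rewrite lerXn2r ?nnegrE.
  by rewrite sumr_const card_ord mulr_natl.
move=> /le_lt_trans; apply.
have [->|an0] := eqVneq a 0; first by rewrite expr0n mulr0 exprn_gt0.
apply: (@lt_le_trans _ _ ((a * n.+1%:R) ^+ 2)); last first.
  by rewrite lerXn2r ?nnegrE ?mulr_ge0// ltW.
rewrite exprMn mulrC ltr_pM2l ?exprn_even_gt0//.
rewrite -natrX ltr_nat expnS expn1; exact: leq_pmull.
Qed.

(** The ambient topology comes from the sup norm; this is where it is traded for
    Euclidean balls. *)
Lemma nbhs_euclP x (A : set 'rV[R]_n) :
  nbhs x A <-> exists2 e : R, 0 < e & forall y, eucl_dist x y < e -> A y.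
Proof.
split=> [/nbhs_ballP[e /= e0 eA]|[e e0 eA]].
  exists e => // y xy; apply: eA; split=> // i j; rewrite ord1 /ball/=.
  by have := coord_le_eucl_norm (x - y) j; rewrite !mxE => /le_lt_trans; apply.
apply/nbhs_ballP; exists (e / n.+1%:R); first by rewrite /= divr_gt0.
move=> y [_ xy]; apply: eA; apply: (@eucl_norm_lt_coord _ (e / n.+1%:R)) => //.
  by rewrite divfK.
by move=> i; have /ltW := xy 0 i; rewrite !mxE.
Qed.

Lemma closure_euclP x (A : set 'rV[R]_n) :
  closure A x <-> forall e, 0 < e -> exists2 y, A y & eucl_dist x y < e.
Proof.
split=> [xA e e0|xA B /nbhs_euclP[e e0 eB]].
  have /xA[y [Ay ye]] : nbhs x [set y | eucl_dist x y < e].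
    by apply/nbhs_euclP; exists e.
  by exists y.
by have [y Ay /eB By] := xA _ e0; exists y.
Qed.

Lemma bounded_eucl (A : set 'rV[R]_n) : bounded_set A ->
  exists2 D : R, 0 < D & forall x, A x -> forall i, `|x 0 i| <= D.
Proof.
move=> [M [_ MA]]; exists (`|M| + 1) => [|x Ax i]; first by rewrite ltr_wpDl.
apply: le_trans (MA (`|M| + 1) _ x Ax); last by rewrite ltr_pwDr// ler_norm.
rewrite /Num.Def.normr/= mx_normrE.
by apply: (@le_bigmax _ _ _ 0 (fun ij => `|x ij.1 ij.2|) (ord0, i)).
Qed.

Lemma bounded_dist (A B : set 'rV[R]_n) : bounded_set A -> bounded_set B ->
  exists2 D : R, 0 < D & forall x y, A x -> B y -> eucl_dist x y <= D.
Proof.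
move=> /bounded_eucl[D D0 AD] /bounded_eucl[E E0 BE].
exists ((D + E) * n.+1%:R) => [|x y Ax By]; first by rewrite mulr_gt0 ?addr_gt0.
apply/ltW; apply: (@eucl_norm_lt_coord _ (D + E)) => // [|i].
  by rewrite mulr_gt0 ?addr_gt0.
by rewrite !mxE; apply: le_trans (ler_normB _ _) _; rewrite lerD ?AD ?BE.
Qed.

End Euclidean.

(** * Similarities *)

Section Similarity.
Variables (R : realType) (n : nat).
Implicit Types (x y z : 'rV[R]_n) (g h : 'rV[R]_n -> 'rV[R]_n).

Definition similarity (r : R) g :=
  0 < r /\ forall x y, eucl_dist (g x) (g y) = r * eucl_dist x y.

Lemma similarity_id : similarity 1 id.
Proof. by split=> // x y; rewrite mul1r. Qed.

Lemma similarity_comp r1 r2 g1 g2 :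
  similarity r1 g1 -> similarity r2 g2 -> similarity (r1 * r2) (g1 \o g2).
Proof.
move=> [r1_gt0 e1] [r2_gt0 e2].
by split=> [|x y]; rewrite ?mulr_gt0//= e1 e2 mulrA.
Qed.

Lemma similarity_inj r g : similarity r g -> injective g.
Proof.
move=> [r_gt0 e] x y gxy; have /esym/eqP := e x y.
rewrite gxy eucl_distxx mulf_eq0 gt_eqF//= => /eqP xy0.
apply/eqP; rewrite -subr_eq0; apply/eqP/dot_eq0.
by rewrite -sqr_eucl_norm -/(eucl_dist x y) xy0 expr0n.
Qed.

(** Polarization turns preservation of distances into preservation of dot
    products: h = g - g(0) satisfies h(x).h(z) = r^2 x.z.  If A has the rows
    h(e_i), this reads h(x) A^T = r^2 x, and in particular A A^T = r^2, so that
    A^T is invertible and h(x) = v can be solved for x. *)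
Lemma similarity_surj r g : similarity r g -> forall y, exists x, g x = y.
Proof.
move=> [r_gt0 gr] y; pose h x := g x - g 0.
have hh x z : dot (h x) (h z) = r ^+ 2 * dot x z.
  have polar u v : dot u v = (dot u u + dot v v - dot (u - v) (u - v)) / 2.
    by rewrite !(dotBl, dotBr) (dotC v u); field.
  have sq u v : dot (g u - g v) (g u - g v) = r ^+ 2 * dot (u - v) (u - v).
    by rewrite -!sqr_eucl_norm -!/(eucl_dist _ _) gr exprMn.
  rewrite polar [dot x z]polar /h opprB addrA subrK !sq !subr0.
  by field.
pose A : 'M[R]_n := \matrix_i h (delta_mx 0 i).
have hA x : h x *m A^T = r ^+ 2 *: x.
  apply/rowP => j; rewrite !mxE.
  transitivity (dot (h x) (h (delta_mx 0 j))).
    by apply: eq_bigr => k _; rewrite !mxE.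
  rewrite hh; congr (_ * _); rewrite /dot (bigD1 j)//= big1 => [|k kj].
    by rewrite mxE !eqxx mulr1 addr0.
  by rewrite mxE (negPf kj) andbF mulr0.
have r2 : r ^+ 2 != 0 by rewrite expf_neq0// gt_eqF.
have AA : A *m (r ^- 2 *: A^T) = 1%:M.
  apply/row_matrixP => i; rewrite row_mul rowK -scalemxAr hA scalerA mulVf//.
  by rewrite scale1r row1.
have {}AA := mulmx1C AA.
have cancel u : u *m A^T *m (r ^- 2 *: A) = u.
  by rewrite -scalemxAr -mulmxA scalemxAr scalemxAl AA mulmx1.
exists (r ^- 2 *: ((y - g 0) *m A^T)).
apply: (addIr (- g 0)); rewrite -/(h _) -[LHS]cancel hA.
by rewrite scalerA mulfV// scale1r cancel.
Qed.

(** Surjectivity makes similarities open, with explicit radii. *)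
Lemma similarity_ball r g x y e : similarity r g ->
  eucl_dist (g x) y < r * e -> exists2 z, eucl_dist x z < e & g z = y.
Proof.
move=> sg; have [z <-] := similarity_surj sg y.
by have [r0 ->] := sg; rewrite ltr_pM2l// => ?; exists z.
Qed.

End Similarity.

(** * A volume bound for disjoint balls *)

Section Packing.
Variable R : realType.

Lemma sum_card_disjoint (T I : finType) (G : I -> {pred T}) :
  (forall i j x, x \in G i -> x \in G j -> i = j) ->
  (\sum_i #|G i| <= #|T|)%N.
Proof.
move=> Gd; under eq_bigr do rewrite -sum1_card big_mkcond/=.
rewrite exchange_big/= -sum1_card; apply: leq_sum => x _.
case: (pickP (fun i => x \in G i)) => [i Gi|G0]; last first.
  by rewrite big1// => i _; rewrite G0.
rewrite (bigD1 i)//= Gi big1// => j ji.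
by case: ifP => // Gj; rewrite (Gd _ _ _ Gj Gi) eqxx in ji.
Qed.

(** The floor m of a / h is at least 1, hence at least half of a / h, and the m
    grid points that follow c lie within distance a of c.  The grid starts at -L,
    so index k stands for the point h k - L. *)
Lemma card_grid_interval (K : nat) (c L a h : R) :
  0 < h -> h <= a -> `|c| + a <= L -> 2 * L / h < K%:R ->
  a / (2 * h) <= #|[pred k : 'I_K | `|h * k%:R - L - c| <= a]|%:R.
Proof.
move=> h0 ha cL LK.
have a0 : 0 < a by apply: lt_le_trans ha.
have [cl cu] : - L <= c - a /\ c + a <= L.
  have := ler_norm c; have := ler_norm (- c); rewrite normrN.
  by move=> *; split; lra.
have cLh0 : 0 <= (c + L) / h by apply: divr_ge0; lra.
pose k0 := Num.truncn ((c + L) / h); pose m := Num.truncn (a / h).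
have /andP[k0l k0u] : k0%:R <= (c + L) / h < k0.+1%:R by rewrite truncn_itv.
have /andP[ml mu] : m%:R <= a / h < m.+1%:R.
  by rewrite truncn_itv// divr_ge0// ltW.
have m1 : (1 <= m)%N by rewrite truncn_gt0 ler_pdivlMr ?mul1r.
have jK (j : 'I_m) : (k0 + j.+1 < K)%N.
  rewrite -(@ltr_nat R); apply: le_lt_trans LK.
  rewrite natrD; apply: (@le_trans _ _ ((c + L) / h + a / h)).
    by apply: lerD => //; apply: le_trans ml; rewrite ler_nat.
  by rewrite -mulrDl ler_pM2r ?invr_gt0//; lra.
pose f j := Ordinal (jK j).
have f_inj : injective f.
  by move=> i j /(congr1 val)/= /addnI[] /val_inj.
apply: (@le_trans _ _ m%:R).
  rewrite ler_pdivrMr ?mulr_gt0// mulrA -ler_pdivrMr//.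
  have : 1 <= m%:R :> R by rewrite ler1n.
  by rewrite -natr1 in mu; lra.
rewrite ler_nat -[m]card_ord -(card_codom f_inj).
apply: subset_leq_card; apply/fintype.subsetP => _ /codomP[j ->].
rewrite !inE/=.
have jm : j.+1%:R * h <= a.
  by rewrite -ler_pdivlMr//; apply: le_trans ml; rewrite ler_nat.
rewrite ler_pdivlMr// in k0l; rewrite ltr_pdivrMr// in k0u.
rewrite -[k0.+1%:R]natr1 in k0u.
have j1 : h <= j.+1%:R * h by rewrite ler_peMl// ?ler1n// ltW.
rewrite natrD ler_norml; apply/andP; split; lra.
Qed.

(** Each ball contains a cube of half-edge a_i = r_i / (n + 1), so it contains at
    least (a_i / 2h)^n points of a lattice of mesh h, while the lattice has at
    most (3L / h)^n points in all.  The mesh is the least of the a_i and L, so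
    that every cube sees the lattice; it cancels from the final bound. *)
Lemma packing_bound (n : nat) (I : finType) (c : I -> 'rV[R]_n) (r : I -> R)
    (L : R) :
  0 < L -> (forall i, 0 < r i) -> (forall i t, `|c i 0 t| + r i <= L) ->
  (forall i j x, eucl_dist x (c i) < r i -> eucl_dist x (c j) < r j -> i = j) ->
  \sum_i r i ^+ n <= (6 * L * n.+1%:R) ^+ n.
Proof.
move=> L0 r0 crL rd; pose a i := r i / n.+1%:R.
have a0 i : 0 < a i by rewrite divr_gt0.
have ar i : a i <= r i by rewrite ler_pdivrMr// ler_peMr ?ler1n// ltW.
pose h := \big[Num.min/L]_i a i.
have h0 : 0 < h.
  by rewrite /h; elim/big_ind: _ => // x y x0 y0; rewrite lt_min x0.
have ha i : h <= a i by apply: bigmin_le.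
have hL : h <= L by apply: bigmin_le_id.
pose K := (Num.truncn (2 * L / h)).+1.
have /andP[Kl Ku] : K.-1%:R <= 2 * L / h < K%:R.
  by rewrite truncn_itv// divr_ge0 ?mulr_ge0 ?ltW.
have {}Kl : K%:R <= 3 * L / h.
  have : 1 <= L / h by rewrite ler_pdivlMr ?mul1r.
  by rewrite -[K%:R]/(K.-1.+1%:R) -natr1 -mulrA; rewrite -mulrA in Kl; lra.
pose G i :=
  family (fun t => [pred k : 'I_K | `|h * k%:R - L - c i 0 t| <= a i]).
have Gd i j f : f \in G i -> f \in G j -> i = j.
  pose p : 'rV[R]_n := \row_t (h * (f t)%:R - L).
  have Gp k : f \in G k -> eucl_dist p (c k) < r k.
    move=> /familyP fk; apply: (@eucl_norm_lt_coord _ _ _ (a k)) => //.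
      by rewrite divfK.
    by move=> t; have := fk t; rewrite !mxE inE.
  by move=> /Gp fi /Gp; apply: rd fi.
have Gcard i : (a i / (2 * h)) ^+ n <= #|G i|%:R.
  rewrite card_family foldrE big_map big_enum/= natr_prod.
  rewrite -[n in _ ^+ n]card_ord -prodr_const; apply: ler_prod => t _.
  apply/andP; split; first by rewrite ltW// divr_gt0 ?mulr_gt0.
  apply: (card_grid_interval (L := L)) => //.
  by apply: le_trans (crL i t); rewrite lerD2l.
have : \sum_i (a i / (2 * h)) ^+ n <= (3 * L / h) ^+ n.
  apply: (@le_trans _ _ (K%:R ^+ n)); last first.
    by rewrite lerXn2r ?nnegrE//; apply/ltW; rewrite divr_gt0 ?mulr_gt0.
  apply: (@le_trans _ _ (\sum_i #|G i|%:R)); first exact: ler_sum.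
  rewrite -natr_sum -natrX ler_nat; apply: leq_trans (sum_card_disjoint Gd) _.
  by rewrite card_ffun !card_ord.
have hn0 : 0 < (2 * h * n.+1%:R) ^+ n by rewrite exprn_gt0// !mulr_gt0.
rewrite -(ler_pM2r hn0) mulr_suml -exprMn.
have -> : 3 * L / h * (2 * h * n.+1%:R) = 6 * L * n.+1%:R.
  by rewrite mulrA -!mulrA (mulrCA h^-1) mulKf ?gt_eqF//; ring.
move=> /(le_trans _); apply; apply: ler_sum => i _.
by rewrite -exprMn mulrA divfK ?gt_eqF ?mulr_gt0// divfK.
Qed.

End Packing.

(** * The attractor is the closure of the open set *)

Section IFS.
Variables (R : realType) (n M : nat).
Variables (rho : 'I_M -> R) (s : 'I_M -> 'rV[R]_n -> 'rV[R]_n).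
Hypothesis s_sim : forall m, similarity (rho m) (s m).
Hypothesis rho_lt1 : forall m, rho m < 1.

Let rho_gt0 m : 0 < rho m. Proof. by case: (s_sim m). Qed.

Section OpenSet.
Variable O : set 'rV[R]_n.
Hypothesis O_bounded : bounded_set O.
Hypothesis O_open : open O.
Hypothesis O_inv : forall m x, O x -> O (s m x).
Hypothesis O_disj : forall m m' x x', O x -> O x' -> s m x = s m' x' -> m = m'.
Hypothesis rho_sum : \sum_m rho m ^+ n = 1.

(** One ball that misses all the tiles s_m(O) breeds disjoint balls: a packing
    of O is mapped to packings of the disjoint tiles, which as
    sum rho_m ^ n = 1 have together the same n-th power sum, and the new ball
    can be added to them.  Each round therefore gains r0 ^ n. *)
Lemma packing_tower (x0 : 'rV[R]_n) (r0 : R) (k : nat) : 0 < r0 ->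
  (forall x, eucl_dist x x0 < r0 -> O x) ->
  (forall x m y, eucl_dist x x0 < r0 -> O y -> x <> s m y) ->
  exists (I : finType) (c : I -> 'rV[R]_n) (r : I -> R),
    [/\ forall i, 0 < r i <= r0,
        forall i x, eucl_dist x (c i) < r i -> O x,
        forall i j x, eucl_dist x (c i) < r i -> eucl_dist x (c j) < r j ->
          i = j &
        \sum_i r i ^+ n = k%:R * r0 ^+ n].
Proof.
move=> r0_gt0 ball_O ball_new.
elim: k => [|k [I [c [r [r_gt0 c_O c_disj r_sum]]]]].
  exists 'I_0, (fun=> 0), (fun=> 1); rewrite big_ord0 mul0r.
  by split => // -[].
pose c' (a : unit + 'I_M * I) := if a is inr p then s p.1 (c p.2) else x0.
pose r' (a : unit + 'I_M * I) := if a is inr p then rho p.1 * r p.2 else r0.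
have pull m i x : eucl_dist x (s m (c i)) < rho m * r i ->
    exists2 y, eucl_dist y (c i) < r i & s m y = x.
  rewrite eucl_distC => /(similarity_ball (s_sim m))[y].
  by rewrite eucl_distC; exists y.
exists (unit + 'I_M * I)%type, c', r'; split.
- move=> [_|[m i]]/=; first by rewrite r0_gt0 lexx.
  have /andP[ri ri0] := r_gt0 i; rewrite mulr_gt0//=.
  by apply: le_trans ri0; apply: ler_piMl; apply: ltW.
- move=> [_|[m i]] x /=; first exact: ball_O.
  by move=> /pull[y /c_O Oy <-]; apply: O_inv.
- move=> [[]|[m i]] [[]|[m' j]] x //=.
  + by move=> xx0 /pull[y /c_O Oy yx]; case: (ball_new x m' y).
  + by move=> /pull[y /c_O Oy yx] xx0; case: (ball_new x m y).
  + move=> /pull[y yi yx] /pull[y' yj y'x].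
    have mm' : m = m' by apply: (O_disj (c_O _ _ yi) (c_O _ _ yj)); rewrite yx.
    rewrite -mm' in y'x *; congr (inr (_, _)).
    apply: (c_disj _ _ y) => //.
    by rewrite (similarity_inj (s_sim m) (etrans yx (esym y'x))).
- rewrite big_sumType/= big_const card_unit/= addr0 -natr1 mulrDl mul1r addrC.
  congr (_ + _); rewrite -(pair_bigA _ (fun m i => (rho m * r i) ^+ n))/=.
  under eq_bigr do under eq_bigr do rewrite exprMn.
  under eq_bigr do rewrite -mulr_sumr r_sum.
  by rewrite -mulr_suml rho_sum mul1r.
Qed.

(** A point of O away from all tiles is the centre of a ball as in
    [packing_tower], whose k rounds contradict [packing_bound] for large k. *)
Lemma images_dense (x0 : 'rV[R]_n) (e : R) : O x0 -> 0 < e ->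
  exists m, exists2 y, O y & eucl_dist x0 (s m y) < e.
Proof.
move=> Ox0 e0; apply: contrapT => nex.
have /nbhs_euclP[e' e'0 e'O] : nbhs x0 O by apply: O_open.
pose r0 := Num.min e e'.
have r0_gt0 : 0 < r0 by rewrite lt_min e0.
have [D D0 OD] := bounded_eucl O_bounded.
pose B := (6 * (D + r0) * n.+1%:R) ^+ n.
have rn0 : 0 < r0 ^+ n by rewrite exprn_gt0.
have ball_O x : eucl_dist x x0 < r0 -> O x.
  move=> xx0; apply: e'O; rewrite eucl_distC; apply: lt_le_trans xx0 _.
  by rewrite ge_min lexx orbT.
have ball_new x m y : eucl_dist x x0 < r0 -> O y -> x <> s m y.
  move=> xx0 Oy xy; apply: nex; exists m; exists y => //.
  by rewrite -xy eucl_distC; apply: lt_le_trans xx0 _; rewrite ge_min lexx.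
have [I [c [r [r_gt0 c_O c_disj r_sum]]]] :=
  packing_tower (Num.truncn (B / r0 ^+ n)).+1 r0_gt0 ball_O ball_new.
have : \sum_i r i ^+ n <= B.
  apply: (packing_bound (c := c)) => // [|i|i t].
  - by rewrite addr_gt0.
  - by case/andP: (r_gt0 i).
  - have /andP[ri ri0] := r_gt0 i; rewrite lerD// OD//.
    by apply: (c_O i); rewrite eucl_distxx.
rewrite r_sum leNgt => /negP; apply.
by rewrite -ltr_pdivrMr// truncnS_gt.
Qed.

End OpenSet.

Lemma contraction_bound : exists2 q : R, 0 <= q < 1 & forall m, rho m <= q.
Proof.
exists (\big[Num.max/0]_m rho m) => [|m]; last exact: le_bigmax.
apply/andP; split; first exact: bigmax_ge_id.
by apply/bigmax_ltP; split=> // m _.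
Qed.

Lemma contraction_bound_below :
  exists2 a : R, 0 < a <= 1 & forall m, a <= rho m.
Proof.
exists (\big[Num.min/1]_m rho m) => [|m]; last exact: bigmin_le.
apply/andP; split; last exact: bigmin_le_id.
by apply/lt_bigmin.
Qed.

Lemma expr_small (q e : R) : 0 <= q < 1 -> 0 < e -> exists k, q ^+ k < e.
Proof.
move=> /andP[q0 q1] e0.
have : (fun k => q ^+ k) @ \oo --> (0 : R).
  by apply: cvg_expr; rewrite ger0_norm.
move=> /cvgrPdist_lt/(_ e e0)[k _ /(_ k (leqnn k))].
by rewrite sub0r normrN ger0_norm ?exprn_ge0//; exists k.
Qed.

(** The contraction argument for uniqueness of attractors, in a form where A need
    only be covered by its images up to arbitrarily small errors: pulling a point
    of A back k times and choosing a point of F there gives, after mapping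
    forward, a point of F at distance at most q^k D plus errors.  It serves for
    both inclusions between the attractor and the closure of O. *)
Lemma approx_invariant_sub (A F : set 'rV[R]_n) (D : R) : 0 < D ->
  (forall x, A x -> exists2 y, F y & eucl_dist x y <= D) ->
  (forall x e, A x -> 0 < e ->
     exists m, exists2 y, A y & eucl_dist x (s m y) < e) ->
  (forall m x, F x -> F (s m x)) ->
  A `<=` closure F.
Proof.
move=> D0 AD A_cover F_inv x Ax.
have [q /andP[q0 q1] rho_q] := contraction_bound.
have step k : forall e x, 0 < e -> A x ->
    exists2 y, F y & eucl_dist x y <= q ^+ k * D + e.
  elim: k => [|k IHk] e {Ax}x e0 Ax.
    have [y Fy xy] := AD x Ax; exists y => //; rewrite expr0 mul1r.
    by apply: le_trans xy _; rewrite lerDl ltW.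
  have [|m [y Ay xy]] := A_cover x (e / 2) Ax; first by rewrite divr_gt0.
  have [|z Fz yz] := IHk (e / 2) y _ Ay; first by rewrite divr_gt0.
  exists (s m z); first exact: F_inv.
  apply: le_trans (eucl_dist_triangle (s m y) _ _) _.
  rewrite (s_sim m).2 exprS.
  have : rho m * eucl_dist y z <= q * (q ^+ k * D) + e / 2.
    apply: (@le_trans _ _ (rho m * (q ^+ k * D) + rho m * (e / 2))).
      by rewrite -mulrDr ler_pM2l.
    apply: lerD; first by rewrite ler_wpM2r// mulr_ge0 ?exprn_ge0// ltW.
    by apply: ler_piMl; [rewrite divr_ge0// ltW|apply: ltW].
  by rewrite mulrA; lra.
apply/closure_euclP => e e0.
have [k qk] : exists k, q ^+ k < e / 2 / D.
  by apply: expr_small; [rewrite q0|rewrite !divr_gt0].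
have [|y Fy xy] := step k (e / 2) x _ Ax; first by rewrite divr_gt0.
exists y => //; apply: le_lt_trans xy _.
by rewrite ltr_pdivlMr// in qk; lra.
Qed.

End IFS.

(** * From porosity to transfer of cubes *)

(** Off the boundary, A agrees with its interior and with its closure, so it
    would cut a clopen piece out of C. *)
Lemma connected_boundary (T : topologicalType) (C A : set T) :
  connected C -> C `&` A !=set0 -> C `\` A !=set0 -> C `&` boundary A !=set0.
Proof.
move=> C_conn CA [y [Cy nAy]]; apply: contrapT => CB0; apply: nAy.
have CAi : C `&` A = C `&` A°.
  rewrite predeqE => z; split=> -[Cz Az]; split=> //; last first.
    exact: interior_subset.
  apply: contrapT => nAz; apply: CB0; exists z.
  by split=> //; split=> //; apply: subset_closure.
have CAc : C `&` A = C `&` closure A.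
  rewrite predeqE => z; split=> -[Cz Az]; split=> //.
    exact: subset_closure.
  apply: interior_subset; apply: contrapT => nAz; apply: CB0; exists z.
  by split=> //; split.
suff CAC : C `&` A = C by move: Cy; rewrite -CAC => -[].
apply: C_conn => //; first by exists A° => //; exact: open_interior.
by exists (closure A) => //; exact: closed_closure.
Qed.

Section Transfer.
Variables (R : realType) (n : nat).
Implicit Types (A B S : set 'rV[R]_n).

Lemma segment_boundary A (x y : 'rV[R]_n) : A x -> ~ A y ->
  exists2 b, boundary A b & eucl_dist y b <= eucl_dist x y.
Proof.
move=> Ax nAy; pose f (t : R) : 'rV[R]_n := t *: (y - x) + x.
have f_cont : continuous f.
  by move=> t; apply: cvgD; [apply: cvgZr_tmp; exact: cvg_id|exact: cvg_cst].
have : connected (f @` `[0, 1]).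
  apply: connected_continuous_connected; first exact: segment_connected.
  exact: continuous_subspaceT.
move=> /(@connected_boundary _ _ A)[||b [[t]]].
- exists x; split=> //; exists 0; first by rewrite /= in_itv/= lexx ler01.
  by rewrite /f scale0r add0r.
- exists y; split=> //; exists 1; first by rewrite /= in_itv/= lexx ler01.
  by rewrite /f scale1r subrK.
rewrite /= in_itv/= => /andP[t0 t1] <- ftA; exists (f t) => //.
have -> : eucl_dist y (f t) = (1 - t) * eucl_dist x y.
  rewrite [eucl_dist x y]eucl_distC /eucl_dist.
  have -> : y - f t = (1 - t) *: (y - x).
    by rewrite scalerBl scale1r opprD addrA addrAC.
  by rewrite eucl_normZ ger0_norm// subr_ge0.
by apply: ler_piMl; [exact: eucl_dist_ge0|rewrite gerBl].
Qed.

(** Thickness tests the scales 2^-j, none above 1, and a bounded attractor has no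
    arbitrarily large tiles; hence the restriction on t. *)
Definition porous_at B S := exists c C : R, [/\ 0 < c, 0 < C &
  forall x t, B x -> 0 < t <= 1 ->
    exists2 z, eucl_dist x z <= C * t & forall y, eucl_dist z y < c * t -> S y].

Lemma set_dist_le A B x y : A x -> B y -> set_dist A B <= eucl_dist x y.
Proof.
move=> Ax By; apply: ge_inf; last by exists x => //; exists y.
by exists 0 => _ [u _ [v _ <-]]; apply: eucl_dist_ge0.
Qed.

Lemma le_set_dist A B e : A !=set0 -> B !=set0 ->
  (forall x y, A x -> B y -> e <= eucl_dist x y) -> e <= set_dist A B.
Proof.
move=> [x Ax] [y By] h; apply: lb_le_inf.
  by exists (eucl_dist x y), x => //; exists y.
by move=> _ [u Au [v Bv <-]]; apply: h.
Qed.

(** The infimum of the empty set is 0, so a positive distance already forces both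
    sets to be nonempty. *)
Lemma set_dist_lt A B e : 0 < set_dist A B -> set_dist A B < e ->
  exists x y, [/\ A x, B y & eucl_dist x y < e].
Proof.
move=> AB0 ABe; have : [set eucl_dist x y | x in A & y in B] !=set0.
  by apply/set0P; apply: contraTneq AB0 => AB0; rewrite /set_dist AB0 inf0 ltxx.
by move=> /inf_lt/(_ ABe)[_ [x Ax [y By <-]]]; exists x, y.
Qed.

Lemma cube_center_at (z : 'rV[R]_n) (a : R) : 0 < a ->
  exists Q : cube R n, [/\ edge Q = 2 * a, cube_set Q z &
    forall y, cube_set Q y -> forall i, `|y 0 i - z 0 i| <= a].
Proof.
move=> a0; have a20 : 0 < 2 * a by rewrite mulr_gt0.
exists (@Cube R n (z - const_mx a) (2 * a) a20); split=> //.
  by move=> i /=; rewrite !mxE; apply/andP; split; lra.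
move=> y Qy i; have := Qy i; rewrite /= !mxE => /andP[yl yr].
by rewrite ler_norml; apply/andP; split; lra.
Qed.

Lemma cube_nonempty (Q : cube R n) : cube_set Q !=set0.
Proof.
exists (corner Q + const_mx (edge Q / 2)) => i; rewrite !mxE.
by have := edge_gt0 Q; move=> Q0; apply/andP; split; lra.
Qed.

(** Take a boundary point b within (c4 + 1) t of Q, where t = 2^-j, and a ball of
    radius c t off A near b.  The new cube lies in the concentric ball of half
    that radius, so it stays c t / 2 away from the boundary. *)
Lemma porous_transfer A : porous_at (boundary A) (~` A) ->
  cube_transfer A (~` A) (boundary A).
Proof.
move=> [c [C [c0 C0 por]]] c1 c2 c3 c4 j0 c1_gt0 c2_gt0 c3_gt0 c4_gt0.
pose a := c / 2 / n.+1%:R; have a0 : 0 < a by rewrite !divr_gt0.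
exists (2 * a), (2 * a), (c / 2), (c4 + 1 + C); split.
  by rewrite !mulr_gt0 ?divr_gt0 ?addr_gt0.
move=> j Q _ QA _; set t : R := 2 ^- j => /andP[Ql Qu].
have t01 : 0 < t <= 1.
  by rewrite invr_gt0 exprn_gt0//= invf_le1 ?exprn_gt0// exprn_ege1// ler1n.
have /andP[t0 t1] := t01.
have [||x [b [Qx Bb xb]]] :=
  @set_dist_lt (cube_set Q) (boundary A) ((c4 + 1) * t).
- by apply: lt_le_trans Ql; rewrite mulr_gt0.
- by apply: le_lt_trans Qu _; rewrite ltr_pM2r// ltrDl.
have [z bz zA] := por b t Bb t01.
have [Q' [Q'e Q'z Q'i]] := @cube_center_at z (a * t) (mulr_gt0 a0 t0).
have Q'near y : cube_set Q' y -> eucl_dist z y < c / 2 * t.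
  move=> Q'y; rewrite eucl_distC.
  apply: (@eucl_norm_lt_coord _ _ _ (a * t)).
  - by rewrite !mulr_gt0 ?divr_gt0.
  - by rewrite mulrAC /a divfK.
  - by move=> i; have := Q'i y Q'y i; rewrite !mxE.
have Q'A : cube_set Q' `<=` ~` A.
  move=> y /Q'near zy; apply: zA; apply: lt_trans zy _.
  by rewrite ltr_pM2r//; lra.
exists Q'; split=> //.
- by rewrite Q'e mulrA lexx.
- apply: le_set_dist; [exact: cube_nonempty|by exists b|].
  move=> y b' /Q'near zy Bb'.
  rewrite leNgt; apply/negP => yb'.
  (* b' is in the closure of A, yet a ball around it would lie off A. *)
  have /Bb'.1[u [/= Au]] : nbhs b' (~` A).
    apply/nbhs_euclP; exists (c / 2 * t - eucl_dist y b').
      by rewrite subr_gt0.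
    move=> u b'u; apply: zA.
    have := eucl_dist_triangle y z u; have := eucl_dist_triangle b' y u.
    lra.
  by [].
- apply: le_set_dist; [exact: cube_nonempty|exact: cube_nonempty|].
  move=> q q' Qq Q'q'; have [b' Bb'] := segment_boundary (QA _ Qq) (Q'A _ Q'q').
  by apply: le_trans; apply: set_dist_le.
- apply: le_trans (set_dist_le Qx Q'z) _.
  have := eucl_dist_triangle b x z; rewrite mulrDl in xb; rewrite 2!mulrDl; lra.
Qed.

End Transfer.

(** * Porosity of both sides of the attractor *)

Section Tiling.
Variables (R : realType) (n M : nat).
Variables (rho : 'I_M -> R) (s : 'I_M -> 'rV[R]_n -> 'rV[R]_n).
Hypothesis s_sim : forall m, similarity (rho m) (s m).
Hypothesis rho_lt1 : forall m, rho m < 1.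
Variable G : set 'rV[R]_n.
Hypothesis G_bounded : bounded_set G.
Hypothesis G_inv : forall m x, G x -> G (s m x).
Hypothesis G_cover : forall x, G x -> exists m, exists2 y, G y & s m y = x.
Hypothesis G_sep : forall m m' x y, G° x -> G y -> s m x = s m' y -> m = m'.
Hypothesis G_int : G° !=set0.

Let rho_gt0 m : 0 < rho m. Proof. by case: (s_sim m). Qed.

Definition word_ratio (w : seq 'I_M) : R := \prod_(m <- w) rho m.

Definition word_map (w : seq 'I_M) : 'rV[R]_n -> 'rV[R]_n :=
  foldr (fun m f => s m \o f) id w.

Lemma word_sim w : similarity (word_ratio w) (word_map w).
Proof.
elim: w => [|m w IHw]; rewrite /word_ratio ?big_nil ?big_cons.
  exact: similarity_id.
exact: similarity_comp.
Qed.

Lemma word_ratio_gt0 w : 0 < word_ratio w.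
Proof. by case: (word_sim w). Qed.

Lemma word_inv w x : G x -> G (word_map w x).
Proof. by elim: w => //= m w IHw /IHw; apply: G_inv. Qed.

Lemma word_inv_int w x : G° x -> G° (word_map w x).
Proof.
move=> /nbhs_euclP[e e0 eG]; apply/nbhs_euclP.
exists (word_ratio w * e); first by rewrite mulr_gt0 ?word_ratio_gt0.
by move=> y /(similarity_ball (word_sim w))[z /eG Gz <-]; apply: word_inv.
Qed.

Lemma int_ball :
  exists p e, [/\ G p, 0 < e & forall x, eucl_dist p x < e -> G° x].
Proof.
have [p /nbhs_euclP[e e0 eG]] := G_int; exists p, e; split=> //.
  by apply: eG; rewrite eucl_distxx.
move=> x px; apply/nbhs_euclP; exists (e - eucl_dist p x).
  by rewrite subr_gt0.
by move=> y xy; apply: eG; have := eucl_dist_triangle x p y; lra.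
Qed.

Variable a : R.
Hypothesis a01 : 0 < a <= 1.
Hypothesis a_rho : forall m, a <= rho m.

Let a_gt0 : 0 < a. Proof. by case/andP: a01. Qed.

Let word_ratio_cons t m w : a * (t / rho m) <= word_ratio w <= t / rho m ->
  a * t <= word_ratio (m :: w) <= t.
Proof.
rewrite /word_ratio big_cons -/(word_ratio w) => /andP[wl wu].
by rewrite [rho m * _]mulrC -ler_pdivrMr// -mulrA wl/= -ler_pdivlMr.
Qed.

(** Follow an address of x until the ratio first drops below t; the last step
    loses at most a factor a, a lower bound of all ratios. *)
Lemma tile_at_scale t x : 0 < t <= 1 -> G x ->
  exists w, a * t <= word_ratio w <= t /\ exists2 y, G y & word_map w y = x.
Proof.
move=> /andP[t0 t1]; have [q /andP[q0 q1] rho_q] := contraction_bound rho_lt1.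
have [k /ltW qkt] : exists k, q ^+ k < t by apply: expr_small; rewrite ?q0.
elim: k => [|k IHk] in t x t0 t1 qkt *.
  move=> Gx; exists [::]; rewrite /word_ratio big_nil.
  have -> : t = 1 by apply/eqP; rewrite eq_le t1.
  by rewrite mulr1 lexx andbT; split; [case/andP: a01|exists x].
move=> /G_cover[m [y Gy <-]]; have [tm|mt] := leP t (rho m).
  have [||||w [/andP[wl wu] [z Gz zy]]] := IHk (t / rho m) y.
  - by rewrite divr_gt0.
  - by rewrite ler_pdivrMr// mul1r.
  - rewrite ler_pdivlMr//; apply: le_trans qkt; rewrite exprSr.
    by rewrite ler_wpM2l// exprn_ge0.
  - by [].
  exists (m :: w); split; first by apply: word_ratio_cons; rewrite wl.
  by exists z => //=; rewrite zy.
exists [:: m]; rewrite /word_ratio big_seq1; split; last by exists y.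
by rewrite (ltW mt) andbT; apply: le_trans (a_rho m); rewrite ger_pMr.
Qed.

(** If x is in G but not in the tile of w, an address of x leaves the word w at
    some letter.  Past that letter any tile of x has its interior off the tile of
    w; the bound on t keeps the requested scale below the ratio of the letters
    already spent. *)
Lemma tile_off_word w t x : 0 < t <= a ^+ size w -> G x ->
  (forall y, G y -> word_map w y <> x) ->
  exists v, [/\ a * t <= word_ratio v <= t,
    exists2 y, G y & word_map v y = x &
    forall y z, G° y -> G z -> word_map v y <> word_map w z].
Proof.
elim: w t x => [|m w IHw] t x /andP[t0 ta] Gx xw; first by case: (xw x).
have tw m' : 0 < t / rho m' <= a ^+ size w.
  rewrite divr_gt0//= ler_pdivrMr//; apply: le_trans ta _.
  by rewrite exprSr ler_wpM2l// exprn_ge0// ltW.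
have [m' [y Gy yx]] := G_cover Gx; have [mm'|mm'] := eqVneq m' m.
  have [|v [vt [z Gz zy] v_off]] := IHw _ y (tw m) Gy.
    by move=> z Gz zy; apply: (xw z Gz); rewrite /= zy -mm'.
  exists (m :: v); split; first exact: word_ratio_cons.
    by exists z => //=; rewrite zy -mm'.
  by move=> u u' Gu Gu' /= /(similarity_inj (s_sim m)); apply: v_off.
have [|v [vt [z Gz zy]]] := @tile_at_scale (t / rho m') y _ Gy.
  have /andP[-> /le_trans] := tw m'; apply.
  by have /andP[? ?] := a01; rewrite exprn_ile1// ltW.
exists (m' :: v); split; first exact: word_ratio_cons.
  by exists z => //=; rewrite zy.
move=> u u' Gu Gu' /= /G_sep mE; move/eqP: mm'; apply; apply: mE.
  exact: word_inv_int.
exact: word_inv.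
Qed.

Lemma porous_interior : porous_at G G°.
Proof.
have [p [e [Gp e0 eG]]] := int_ball.
have [D D0 GD] := bounded_dist G_bounded G_bounded.
exists (a * e), D; split=> //; first by rewrite mulr_gt0.
move=> x t Gx t01; have [w [/andP[wl wu] [y Gy <-]]] := tile_at_scale t01 Gx.
have /andP[t0 _] := t01.
exists (word_map w p).
  rewrite (word_sim w).2 mulrC.
  rewrite ler_pM ?eucl_dist_ge0 ?(ltW (word_ratio_gt0 w))//.
  exact: GD.
move=> z pz; have : eucl_dist (word_map w p) z < word_ratio w * e.
  by apply: lt_le_trans pz _; rewrite mulrAC ler_wpM2r// ltW.
move=> /(similarity_ball (word_sim w))[u pu <-]; apply: word_inv_int.
exact: eG.
Qed.

(** Let w be a word whose tile has an e/2-neighbourhood inside G.  A point x' off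
    G near x is mapped by w into G but off the tile of w, and [tile_off_word]
    yields a tile of scale t at w(x') with interior off the tile of w.
    The preimage under w of a ball in that interior avoids G. *)
Lemma porous_complement : porous_at (G `&` closure (~` G)) (~` G).
Proof.
have [p [e [Gp e0 eG]]] := int_ball.
have [D D0 GD] := bounded_dist G_bounded G_bounded.
have e20 : 0 < e / 2 by rewrite divr_gt0.
have [w wG] : exists w,
    forall x z, G x -> eucl_dist (word_map w x) z < e / 2 -> G z.
  pose t := Num.min 1 (e / 2 / D).
  have t01 : 0 < t <= 1 by rewrite lt_min ltr01 !divr_gt0//= ge_min lexx.
  have [w [/andP[_ wt] [y Gy yp]]] := tile_at_scale t01 Gp.
  exists w => x z Gx xz; suff : G° z by exact: interior_subset.
  apply: eG; rewrite -yp.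
  apply: le_lt_trans (eucl_dist_triangle (word_map w x) _ _) _.
  rewrite (word_sim w).2 [ltRHS](splitr e); apply: ler_ltD => //.
  apply: (@le_trans _ _ (e / 2 / D * D)); last by rewrite divfK ?gt_eqF.
  apply: ler_pM; rewrite ?eucl_dist_ge0 ?(ltW (word_ratio_gt0 w))//.
    by apply: le_trans wt _; rewrite ge_min lexx orbT.
  exact: GD.
have [r_gt0 w_dist] := word_sim w; set r := word_ratio w in r_gt0 w_dist.
(* Working at scale k t makes [tile_off_word] applicable to every t <= 1. *)
pose k := a ^+ size w; have k_gt0 : 0 < k by rewrite exprn_gt0.
exists (a * k * e / r), (1 + k * D / r); split.
- by rewrite !(divr_gt0, mulr_gt0).
- by rewrite addr_gt0// !(divr_gt0, mulr_gt0).
move=> x t [Gx clx] /andP[t0 t1].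
(* x' must be t-close to x, and close enough for w(x') to remain in G. *)
have et0 : 0 < Num.min t (e / 2 / r) by rewrite lt_min t0 !divr_gt0.
have [x' /= nGx' xx'] := (closure_euclP _ _).1 clx _ et0.
move: xx'; rewrite lt_min => /andP[xx't xx'e].
have Gwx' : G (word_map w x').
  apply: (wG x) => //; rewrite w_dist mulrC -ltr_pdivlMr//.
have [|z Gz zx'|v [/andP[vl vu] [y Gy yx'] v_off]] :=
  @tile_off_word w (k * t) _ _ Gwx'.
- by rewrite mulr_gt0//= -/k ger_pMr.
- by apply: nGx'; rewrite -(similarity_inj (word_sim w) zx').
have [z zp] := similarity_surj (word_sim w) (word_map v p).
exists z.
  apply: le_trans (eucl_dist_triangle x' _ _) _.
  rewrite mulrDl mul1r; apply: lerD; first exact: ltW.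
  rewrite mulrAC ler_pdivlMr// mulrC -w_dist zp -yx'.
  rewrite (word_sim v).2 mulrAC.
  by rewrite ler_pM ?eucl_dist_ge0 ?(ltW (word_ratio_gt0 v))//; apply: GD.
move=> u zu Gu.
have : eucl_dist (word_map v p) (word_map w u) < word_ratio v * e.
  rewrite -zp w_dist -ltr_pdivlMl//; apply: lt_le_trans zu _.
  rewrite [leRHS]mulrC ler_pdivlMr//; apply: le_trans (ler_wpM2r (ltW e0) vl).
  by rewrite le_eqVlt; apply/orP; left; apply/eqP; field; rewrite gt_eqF.
by move=> /(similarity_ball (word_sim v))[u' /eG Gu' /v_off]; apply.
Qed.


End Tiling.

(** * Attractors with the open set condition *)

Lemma boundaryC (T : topologicalType) (A : set T) :
  boundary (~` A) = boundary A.
Proof.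
by rewrite /boundary closure_setC interiorC !setDE setCK setIC.
Qed.

Lemma sub_porous_at (R : realType) (n : nat) (B B' S S' : set 'rV[R]_n) :
  B' `<=` B -> S `<=` S' -> porous_at B S -> porous_at B' S'.
Proof.
move=> BB SS [c [C [c0 C0 por]]]; exists c, C; split=> // x t /BB Bx t01.
by have [z xz zS] := por x t Bx t01; exists z => // y /zS /SS.
Qed.

Section OpenSetAttractor.
Variables (R : realType) (n M : nat).
Variables (rho : 'I_M -> R) (s : 'I_M -> 'rV[R]_n -> 'rV[R]_n).
Hypothesis s_sim : forall m, similarity (rho m) (s m).
Hypothesis rho_lt1 : forall m, rho m < 1.
Hypothesis rho_sum : \sum_m rho m ^+ n = 1.
Variables O G : set 'rV[R]_n.
Hypothesis O_nonempty : O !=set0.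
Hypothesis O_bounded : bounded_set O.
Hypothesis O_open : open O.
Hypothesis O_inv : forall m x, O x -> O (s m x).
Hypothesis O_disj : forall m m' x x', O x -> O x' -> s m x = s m' x' -> m = m'.
Hypothesis G_nonempty : G !=set0.
Hypothesis G_bounded : bounded_set G.
Hypothesis G_closed : closed G.
Hypothesis G_inv : forall m x, G x -> G (s m x).
Hypothesis G_cover : forall x, G x -> exists m, exists2 y, G y & s m y = x.

Lemma attractor_eq_closure : G = closure O.
Proof.
have [D D0 OGD] := bounded_dist O_bounded G_bounded.
rewrite eqEsubset; split; last first.
  suff : O `<=` closure G.
    rewrite -(closure_id G).1// => OG.
    by rewrite [X in _ `<=` X](closure_id G).1//; apply: closureS.
  apply: (approx_invariant_sub s_sim rho_lt1 D0) => // [x Ox|x e Ox e0].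
    by have [g Gg] := G_nonempty; exists g => //; apply: OGD.
  exact: (images_dense s_sim).
apply: (approx_invariant_sub s_sim rho_lt1 D0) => //.
- move=> x Gx; have [p Op] := O_nonempty; exists p => //.
  by rewrite eucl_distC; apply: OGD.
- move=> x e /G_cover[m [y Gy <-]] e0.
  by exists m, y => //; rewrite eucl_distxx.
Qed.

Lemma sub_interior_attractor : O `<=` G°.
Proof.
have OG : O `<=` G by rewrite attractor_eq_closure; apply: subset_closure.
by rewrite -(interior_id O).1//; apply: interiorS.
Qed.

(** O is dense in G, so a common point of s_m(G°) and s_m'(G) can be moved first
    into s_m'(O), without leaving the open set s_m(G°), and then into s_m(O),
    without leaving the open set s_m'(O). *)
Lemma attractor_tiles_disjoint m m' x y :
  G° x -> G y -> s m x = s m' y -> m = m'.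
Proof.
move=> /nbhs_euclP[e e0 eG] Gy sxy.
have clO z : G z -> closure O z by rewrite attractor_eq_closure.
have [y' Oy' yy'] := (closure_euclP _ _).1 (clO _ Gy) (rho m * e / rho m')
  (divr_gt0 (mulr_gt0 (s_sim m).1 e0) (s_sim m').1).
have [x' xx' sxy'] : exists2 x', eucl_dist x x' < e & s m x' = s m' y'.
  apply: (similarity_ball (s_sim m)).
  by rewrite sxy (s_sim m').2 mulrC -ltr_pdivlMr// (s_sim m').1.
have /nbhs_euclP[d d0 dO] : nbhs y' O by apply: O_open.
have [x'' Ox'' xx''] :=
  (closure_euclP _ _).1 (clO _ (eG _ xx')) (rho m' * d / rho m)
  (divr_gt0 (mulr_gt0 (s_sim m').1 d0) (s_sim m).1).
have [y'' yy'' sxy''] : exists2 y'', eucl_dist y' y'' < d & s m' y'' = s m x''.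
  apply: (similarity_ball (s_sim m')).
  by rewrite -sxy' (s_sim m).2 mulrC -ltr_pdivlMr// (s_sim m).1.
by apply: (O_disj Ox'' (dO _ yy'')).
Qed.

End OpenSetAttractor.

Lemma n_attractor_porous (R : realType) (n : nat) (G : set 'rV[R]_n) :
  n_attractor G ->
  [/\ closed G, G <> setT & G !=set0] /\
  [/\ G° !=set0, G `<=` closure G°,
    porous_at (G `\` G°) G° & porous_at (G `\` G°) (~` G)].
Proof.
move=> [M [rho [s [M2 s_contr [U [U0 U_bnd U_open U_sub U_dis]] rho_sum]]]].
move=> [G0 G_cpt GE].
have s_sim m : similarity (rho m) (s m) by have [? _ ?] := s_contr m; split.
have rho_lt1 m : rho m < 1 by have [] := s_contr m.
have U_inv m x : U x -> U (s m x).
  by move=> Ux; apply: U_sub; exists m => //; exists x.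
have U_disj m m' x x' : U x -> U x' -> s m x = s m' x' -> m = m'.
  move=> Ux Ux' sxx'; apply/eqP/negPn/negP => /U_dis mm'.
  by have : set0 (s m x) by rewrite -mm'; split; [exists x|exists x'].
have G_bnd := compact_bounded G_cpt.
have G_closed : closed G by apply: compact_closed => //; apply: norm_hausdorff.
have G_inv m x : G x -> G (s m x).
  by move=> Gx; rewrite GE; exists m => //; exists x.
have G_cover x : G x -> exists m, exists2 y, G y & s m y = x.
  by rewrite {1}GE => -[m _ [y Gy <-]]; exists m, y.
have G_clO := attractor_eq_closure s_sim rho_lt1 rho_sum U0 U_bnd U_open U_inv
  U_disj G0 G_bnd G_closed G_inv G_cover.
have UG := sub_interior_attractor s_sim rho_lt1 rho_sum U0 U_bnd U_open U_inv
  U_disj G0 G_bnd G_closed G_inv G_cover.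
have G_sep := attractor_tiles_disjoint s_sim rho_lt1 rho_sum U0 U_bnd U_open
  U_inv U_disj G0 G_bnd G_closed G_inv G_cover.
have Gi0 : G° !=set0 by have [x /UG] := U0; exists x.
have [a a01 a_rho] := contraction_bound_below s_sim.
split; split=> //.
(* Two maps exist; if G were everything, their images would overlap. *)
- move=> GT; pose m0 := Ordinal (ltnW M2); pose m1 := Ordinal M2.
  have [g Gg] := G0; have [x sx] := similarity_surj (s_sim m0) (s m1 g).
  have : m0 = m1 by apply: (G_sep _ _ _ _ _ Gg sx); rewrite GT interiorT.
  by [].
- by rewrite {1}G_clO; apply: closureS.
- have := porous_interior s_sim rho_lt1 G_bnd G_inv G_cover Gi0 a01 a_rho.
  by apply: sub_porous_at.
- have := porous_complement s_sim rho_lt1 G_bnd G_inv G_cover G_sep Gi0 a01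
    a_rho.
  by apply: sub_porous_at => //; rewrite closure_setC -setDE.
Qed.

Theorem theorem2p8 (R : realType) (n : nat) (Gamma : set 'rV[R]_n)
    (hGamma : n_attractor Gamma) :
  thick (Gamma°) /\ thick (~` Gamma).
Proof.
have [[G_closed G_ne G0] [Gi0 G_cl por_in por_out]] :=
  n_attractor_porous hGamma.
have bd : boundary Gamma = Gamma `\` Gamma°.
  by rewrite /boundary -(closure_id _).1.
have bdi : boundary Gamma° = Gamma `\` Gamma°.
  rewrite /boundary (interior_id (Gamma°)).1; last exact: open_interior.
  congr (_ `\` _); rewrite eqEsubset; split=> //.
  rewrite [X in _ `<=` X](closure_id Gamma).1 //.
  by apply: closureS; exact: interior_subset.
split; split.
- by split=> //; exact: open_interior.
- by move=> GT; apply: G_ne; rewrite -subTset -GT; exact: interior_subset.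
- apply: porous_transfer; rewrite bdi; apply: sub_porous_at por_out => //.
  by apply: subsetC; exact: interior_subset.
(* I-thickness is E-thickness with the set and its complement exchanged. *)
- rewrite /I_thick -{2}[Gamma°]setCK -boundaryC; apply: porous_transfer.
  by rewrite boundaryC bdi setCK.
- split; last exact: closed_openC.
  by apply/set0P; apply/eqP => /(congr1 setC); rewrite setCK setC0.
- by move=> /(congr1 setC); rewrite setCK setCT; apply/eqP/set0P.
- apply: porous_transfer; rewrite boundaryC bd setCK.
  by apply: sub_porous_at por_in => //; exact: interior_subset.
- rewrite /I_thick setCK boundaryC; apply: porous_transfer.
  by rewrite bd.
Qed.
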